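(* Not every regular local superring is a unique factorization superring; that is, there exists a regular local (Noetherian, supercommutative) superring $R$ with $R_{\overline 1}\neq 0$ that is not a unique factorization superring.
   Context: All rings are unitary with $1\neq 0$, and $2$ is a non-zerodivisor in every ring considered. A superring is a $\mathbb{Z}_2$-graded unitary ring $R=R_{\overline 0}\oplus R_{\overline 1}$. All superrings are supercommutative: $xy=(-1)^{|x||y|}yx$ for all homogeneous $x,y$, where $|x|=0$ if $x\in R_{\overline 0}$ and $|x|=1$ if $x\in R_{\overline 1}$. Superrings are assumed to have $R_{\overline 1}\neq 0$. An ideal $\mathfrak{m}$ of $R$ is maximal if $R/\mathfrak{m}$ is a field; $R$ is local if it has a unique maximal ideal. Maximal ideals are $\mathbb{Z}_2$-graded. $R$ is Noetherian if and only if $R_{\overline 0}$ is a Noetherian ring and $R_{\overline 1}$ is a finitely generated $R_{\overline 0}$-module. Krull superdimension: let $R$ be a Noetherian superring whose even part has finite Krull dimension $\mathrm{Kdim}(R_{\overline 0})$. Elements $a_1,\ldots,a_n\in R_{\overline 1}$ form a system of odd parameters of length $n$ if $\mathrm{Kdim}(R_{\overline 0})=\mathrm{Kdim}(R_{\overline 0}/\mathrm{Ann}_{R_{\overline 0}}(a_1\cdots a_n))$, where $\mathrm{Ann}_{R_{\overline 0}}(a)=\{r\in R_{\overline 0}\mid ra=0\}$. $\mathrm{Ksdim}_{\overline 1}(R)$ is the greatest integer $m$ such that there is a system of odd parameters of length $m$; $\mathrm{Ksdim}_{\overline 0}(R)=\mathrm{Kdim}(R_{\overline 0})$; and $\mathrm{Ksdim}(R)$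 is the pair $\mathrm{Ksdim}_{\overline 0}(R)\mid \mathrm{Ksdim}_{\overline 1}(R)$. A local Noetherian superring $(R,\mathfrak{m})$ with residue field $\Bbbk=R/\mathfrak{m}$ is regular if $\mathrm{Ksdim}(R)=\dim_\Bbbk((\mathfrak{m}/\mathfrak{m}^2)_{\overline 0})\mid\dim_\Bbbk((\mathfrak{m}/\mathfrak{m}^2)_{\overline 1})$, where $(\mathfrak{m}/\mathfrak{m}^2)_{\overline 0}$ and $(\mathfrak{m}/\mathfrak{m}^2)_{\overline 1}$ are the even and odd parts of the graded $\Bbbk$-vector space $\mathfrak{m}/\mathfrak{m}^2$. An element $a\in R$ is normal if $aR=Ra$. A non-unit element is irreducible if it cannot be expressed as the product of two non-unit elements. $a$ is associated to $b$ if there are units $u,v$ of $R$ with $a=ubv$. $R$ is a unique factorization superring (UFSR) if: (1) every nonzero non-unit $x\in R$ admits a finite factorization $x=f_1\cdots f_d$ into normal irreducible elements of $R$; and (2) if $x=f_1\cdots f_d=g_1\cdots g_n$ are two such factorizations, then $d=n$ and there is a permutation $\sigma\in\mathbb{S}_n$ such that $f_i$ is associated to $g_{\sigma(i)}$ for all $i$. *)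

(* Defs.v *)
From HB Require Import structures.
From mathcomp Require Import all_boot all_order all_fingroup all_algebra.
From mathcomp Require Import ring_quotient.

Set Implicit Arguments.
Unset Strict Implicit.
Unset Printing Implicit Defensive.

Import GRing.Theory.
Local Open Scope ring_scope.

(* As in ring_quotient, subsets and ideals are boolean predicates; under the
   usual classical axioms these are all the subsets. *)

(* Z_2 is bool, with false the even degree, true the odd degree and (+) (xor)
   the addition; a superring is supercommutative, has a nonzero odd element
   and 2 is not a zero divisor in it. *)
HB.mixin Record NzRing_isSuperRing R of GRing.NzRing R := {
  hpart : bool -> {pred R};
  hpart_zmod : forall i, zmod_closed (hpart i);
  hpart_sum : forall x,
    exists y z, [/\ y \in hpart false, z \in hpart true & x = y + z];
  hpart_direct : forall x, x \in hpart false -> x \in hpart true -> x = 0;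
  hpart1 : 1 \in hpart false;
  hpartM : forall i j x y,
    x \in hpart i -> y \in hpart j -> x * y \in hpart (i (+) j);
  supercommutative : forall i j x y,
    x \in hpart i -> y \in hpart j -> x * y = (-1) ^+ (i && j) * (y * x);
  two_regular : forall x : R, x *+ 2 = 0 -> x = 0;
  odd_nonzero : exists2 x : R, x \in hpart true & x != 0
}.

#[short(type="superRingType")]
HB.structure Definition SuperRing :=
  {R of NzRing_isSuperRing R & GRing.NzRing R}.

Definition even_pred (R : superRingType) : {pred R} := hpart false.
Definition odd_pred (R : superRingType) : {pred R} := hpart true.
Arguments even_pred : clear implicits.
Arguments odd_pred : clear implicits.

(* The ring R_0, as a type. *)
Section EvenPart.
Variable R : superRingType.

Lemma even_subring_closed : subring_closed (even_pred R).
Proof.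
have [_ hB] := @hpart_zmod R false.
by split=> [|//|x y]; [exact: hpart1 | exact: hpartM].
Qed.

HB.instance Definition _ :=
  GRing.isSubringClosed.Build R (even_pred R) even_subring_closed.

Record even_part := EvenPart { even_val :> R; _ : even_val \in even_pred R }.

HB.instance Definition _ := [isSub for even_val].
HB.instance Definition _ := [Choice of even_part by <:].
HB.instance Definition _ := [SubChoice_isSubNzRing of even_part by <:].

Lemma even_mulC : commutative (@GRing.mul even_part).
Proof.
move=> x y; apply: val_inj; rewrite !rmorphM /=.
by rewrite (@supercommutative R _ _ _ _ (valP x) (valP y)) mul1r.
Qed.

HB.instance Definition _ :=
  GRing.PzRing_hasCommutativeMul.Build even_part even_mulC.

(* Ann_{R_0}(a); it is a proper ideal exactly when a is nonzero. *)
Definition even_ann (a : R) (a_neq0 : a != 0) : {pred even_part} :=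
  fun r => even_val r * a == 0.

Lemma even_ann_closed a (a_neq0 : a != 0) : idealr_closed (even_ann a_neq0).
Proof.
split; rewrite ?unfold_in /even_ann /= ?mul0r ?mul1r ?eqxx //.
move=> r u v; rewrite !unfold_in /even_ann /= => /eqP ua /eqP va.
by rewrite mulrDl -mulrA ua va mulr0 addr0.
Qed.

HB.instance Definition _ a (a_neq0 : a != 0) :=
  isIdealr.Build even_part (even_ann a_neq0) (even_ann_closed a_neq0).

End EvenPart.

Definition ideal_closed (R : nzRingType) (I : {pred R}) : Prop :=
  zmod_closed I /\ forall a x, x \in I -> a * x \in I /\ x * a \in I.

(* Chains p_0 < p_1 < ... < p_n of prime ideals. *)
Definition prime_chain (A : comNzRingType) (n : nat)
    (p : 'I_n.+1 -> prime_idealr A) : Prop :=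
  forall i j : 'I_n.+1, (i < j)%N ->
    {subset p i <= p j} /\ exists2 x, x \in p j & x \notin p i.

Definition Kdim_is (A : comNzRingType) (d : nat) : Prop :=
  (exists p : 'I_d.+1 -> prime_idealr A, prime_chain p) /\
  forall n (p : 'I_n.+1 -> prime_idealr A), prime_chain p -> (n <= d)%N.

Definition noetherian (A : comNzRingType) : Prop :=
  forall I : {pred A}, ideal_closed I ->
    exists n (g : 'I_n -> A),
      forall x, x \in I <-> exists c : 'I_n -> A, x = \sum_i c i * g i.

Definition super_noetherian (R : superRingType) : Prop :=
  noetherian (even_part R) /\
  exists n (g : 'I_n -> R), (forall i, g i \in odd_pred R) /\
    forall x, x \in odd_pred R ->
      exists c : 'I_n -> even_part R, x = \sum_i even_val (c i) * g i.

(* The quotient by the annihilator is formed only when the product is nonzero: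
   otherwise it would be the zero ring, which is excluded (and which has no
   prime ideal, hence not the dimension of R_0). *)
Definition odd_parameters (R : superRingType) (n : nat) (a : 'I_n -> R) : Prop :=
  (forall i, a i \in odd_pred R) /\
  exists (a_neq0 : \prod_i a i != 0) (d : nat),
    Kdim_is (even_part R) d /\ Kdim_is {ideal_quot (even_ann a_neq0)} d.

Definition Ksdim_is (R : superRingType) (d0 d1 : nat) : Prop :=
  [/\ Kdim_is (even_part R) d0,
      exists a : 'I_d1 -> R, odd_parameters a
    & forall n (a : 'I_n -> R), odd_parameters a -> (n <= d1)%N].

(* m is an ideal and R/m is a field: nontrivial, commutative, and every nonzero
   class is invertible. *)
Definition maximal_ideal (R : nzRingType) (m : {pred R}) : Prop :=
  [/\ ideal_closed m,
      1 \notin m,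
      forall x y, x * y - y * x \in m
    & forall x, x \notin m -> exists y, x * y - 1 \in m].

Definition local_ring (R : nzRingType) (m : {pred R}) : Prop :=
  maximal_ideal m /\ forall m' : {pred R}, maximal_ideal m' -> m' =i m.

(* Membership in m^2. *)
Definition ideal_sqr (R : nzRingType) (m : {pred R}) (x : R) : Prop :=
  exists n (y z : 'I_n -> R),
    (forall i, y i \in m /\ z i \in m) /\ x = \sum_i y i * z i.

(* The (R/m)-vector space (m/m^2)_i, the image of the elements of m of degree i,
   has dimension d: it has a basis of d classes. The basis vectors are given by
   representatives b, and the scalars in R/m by representatives c. *)
Definition cotangent_dim_is (R : superRingType) (m : {pred R}) (i : bool)
    (d : nat) : Prop :=
  exists b : 'I_d -> R,
  [/\ forall j, b j \in m /\ b j \in hpart i,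
      forall x, x \in m -> x \in hpart i ->
        exists c : 'I_d -> R, ideal_sqr m (x - \sum_j c j * b j)
    & forall c : 'I_d -> R,
        ideal_sqr m (\sum_j c j * b j) -> forall j, c j \in m].

Definition regular_local (R : superRingType) (m : {pred R}) : Prop :=
  [/\ local_ring m,
      super_noetherian R
    & exists d0 d1, [/\ Ksdim_is R d0 d1,
        cotangent_dim_is m false d0 & cotangent_dim_is m true d1]].

(* 2 is not a zero divisor in R/m. *)
Definition two_regular_mod (R : nzRingType) (m : {pred R}) : Prop :=
  forall x, x *+ 2 \in m -> x \in m.

Section UFSR.
Variable R : nzRingType.
Implicit Types x a b : R.

Definition invertible x : Prop := exists y, x * y = 1 /\ y * x = 1.

Definition normal_elt a : Prop :=
  forall x, (exists r, x = a * r) <-> (exists r, x = r * a).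

Definition irreducible_elt x : Prop :=
  ~ invertible x /\
  ~ exists a b, [/\ ~ invertible a, ~ invertible b & x = a * b].

Definition associated a b : Prop :=
  exists u v, [/\ invertible u, invertible v & a = u * b * v].

Definition factorization x d (f : 'I_d -> R) : Prop :=
  (forall i, normal_elt (f i) /\ irreducible_elt (f i)) /\ x = \prod_i f i.

Definition UFSR : Prop :=
  forall x, x != 0 -> ~ invertible x ->
    (exists d (f : 'I_d -> R), factorization x f) /\
    forall d n (f : 'I_d -> R) (g : 'I_n -> R),
      factorization x f -> factorization x g ->
      exists (e : d = n) (s : 'S_n),
        forall i : 'I_d, associated (f i) (g (s (cast_ord e i))).

End UFSR.

(* Main.v *)
Require Import Defs.
From mathcomp Require Import all_boot all_order all_fingroup all_algebra.
From HB Require Import structures.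
From mathcomp Require Import generic_quotient ring_quotient ring.

Set Implicit Arguments.
Unset Strict Implicit.
Unset Printing Implicit Defensive.

Import GRing.Theory.
Local Open Scope ring_scope.
Local Open Scope quotient_scope.

(** The counterexample is the Grassmann algebra over the rationals on two odd
    generators x and y, with basis 1, x, y, xy. It is local, its maximal ideal
    m consisting of the elements with zero constant term.

    It is regular of superdimension 0|2. Its even part has basis 1, xy, so each
    of its elements is a unit or has square zero; this property passes to
    quotients and forces Krull dimension 0 ([Kdim0]). Hence a family of odd
    elements is a system of odd parameters as soon as its product is nonzero:
    x, y is one, while any three odd elements have product zero
    ([grassmann_Ksdim]). On the other side, m^2 is spanned by xy, so m/m^2 is
    purely odd, with basis the classes of x and y.

    It is not a UFSR because xy = (x + y)y, the square of y being zero. The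
    elements x, y and x + y are normal, as is every homogeneous element of a
    superring, and irreducible, since a product of two nonunits lies in m^2 and
    has no linear part. Associated elements of m have proportional linear parts
    ([associated_linear_part]), and x is proportional neither to x + y nor to
    y. *)

(** * Rings whose nonunits have square zero *)

Definition square_zero_or_unit (A : comNzRingType) : Prop :=
  forall x : A, x * x = 0 \/ exists y, x * y = 1.

Section DimensionZero.
Variable A : comNzRingType.
Hypothesis hA : square_zero_or_unit A.

(** The proof argument only serves to attach the prime ideal structure, which
    depends on it, to this predicate. *)
Definition square_zero (_ : square_zero_or_unit A) : {pred A} :=
  fun x => x * x == 0.

(** If u and v have square zero then the cube of a u + v vanishes, so a u + v is
    not a unit; by hypothesis its square is then zero. *)
Lemma square_zero_closed : idealr_closed (square_zero hA).
Proof.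
split; rewrite ?unfold_in /square_zero ?mulr0 ?mulr1 ?oner_eq0 //.
move=> a u v; rewrite !unfold_in /square_zero => /eqP uu /eqP vv.
have [-> //|[w ew]] := hA (a * u + v).
have e1 : (a * u + v) ^+ 3 = 0.
  have -> : (a * u + v) ^+ 3 =
      (a ^+ 3 * u + 3%:R * a ^+ 2 * v) * (u * u)
      + (3%:R * a * u + v) * (v * v) by ring.
  by rewrite uu vv !mulr0 addr0.
have : (1 : A) ^+ 3 = 0 by rewrite -ew exprMn e1 mul0r.
by move/eqP; rewrite expr1n oner_eq0.
Qed.

HB.instance Definition _ :=
  isIdealr.Build A (square_zero hA) square_zero_closed.

Lemma square_zero_prime : prime_idealr_closed (square_zero hA).
Proof.
move=> u v; rewrite !unfold_in /square_zero => /eqP uv.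
have [->|[w uw]] := hA u; first by rewrite eqxx.
have [->|[t vt]] := hA v; first by rewrite eqxx orbT.
have : (u * w) * (u * w) * ((v * t) * (v * t)) = 0.
  have -> : (u * w) * (u * w) * ((v * t) * (v * t)) =
      (u * v * (u * v)) * (w * w * (t * t)) by ring.
  by rewrite uv mul0r.
by rewrite uw vt !mulr1 => /eqP; rewrite oner_eq0.
Qed.

HB.instance Definition _ :=
  isPrimeIdealrClosed.Build A (square_zero hA) square_zero_prime.

(** A prime ideal contains the elements of square zero, and no units. *)
Lemma prime_ideal_square_zero (p : prime_idealr A) x :
  (x \in p) = (x * x == 0).
Proof.
apply/idP/idP => [xp|/eqP xx].
  have [-> //|[y xy]] := hA x.
  by have := idealr1 p; rewrite -xy mulrC idealMr.
by have := prime_idealrM p x x; rewrite xx rpred0 orbb => <-.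
Qed.

Lemma Kdim0 : Kdim_is A 0.
Proof.
split.
  by exists (fun=> square_zero hA : prime_idealr A) => -[[|i] ?] [[|j] ?].
case=> // n p /(_ ord0 ord_max isT) [_ [x]].
by rewrite !prime_ideal_square_zero => ->.
Qed.

End DimensionZero.

Lemma square_zero_or_unit_quotient (A : comNzRingType) (I : idealr A) :
  square_zero_or_unit A -> square_zero_or_unit {ideal_quot I}.
Proof.
move=> hA x; rewrite -[x]reprK; have [xx|[y xy]] := hA (repr x).
  by left; rewrite -[LHS](rmorphM (\pi_{ideal_quot I})) xx rmorph0.
right; exists (\pi y).
by rewrite -[LHS](rmorphM (\pi_{ideal_quot I})) xy rmorph1.
Qed.

(** * Homogeneous elements are normal *)

Section Homogeneous.
Variable R : superRingType.

(** Moving a past r = r0 + r1 turns r into r0 + r1 if a is even and into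
    r0 - r1 if a is odd. *)
Lemma normal_homogeneous i (a : R) : a \in hpart i -> normal_elt a.
Proof.
move=> ai z; split=> -[r ->]; have [r0 [r1 [r0P r1P ->]]] := hpart_sum r.
  exists (r0 + (-1) ^+ i * r1); rewrite mulrDr mulrDl.
  rewrite (supercommutative _ _ _ _ ai r0P) (supercommutative _ _ _ _ ai r1P).
  by rewrite andbF andbT mul1r mulrA.
exists (r0 + (-1) ^+ i * r1); rewrite mulrDr mulrDl.
rewrite (supercommutative _ _ _ _ r0P ai) (supercommutative _ _ _ _ r1P ai).
by rewrite mul1r /= !mulrA (commr_sign a i).
Qed.

End Homogeneous.

(** * The Grassmann algebra on two odd generators *)

(** A quadruple holds the coordinates in the basis 1, x, y, xy. The name hides
    the product ring structure of quadruples. *)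
Definition grassmann (F : numFieldType) : Type := (F * F * F * F)%type.

Section Grassmann.
Variable F : numFieldType.
Local Notation G := (grassmann F).

HB.instance Definition _ := GRing.Zmodule.copy G (F * F * F * F)%type.

Definition Grassmann (a b c d : F) : G := (a, b, c, d).

Definition body (u : G) : F := u.1.1.1.
Definition coefx (u : G) : F := u.1.1.2.
Definition coefy (u : G) : F := u.1.2.
Definition coefxy (u : G) : F := u.2.

Lemma grassmannP (u v : G) : body u = body v -> coefx u = coefx v ->
  coefy u = coefy v -> coefxy u = coefxy v -> u = v.
Proof.
case: u v => [[[a b] c] d] [[[a' b'] c'] d'].
by rewrite /body /coefx /coefy /coefxy /= => -> -> -> ->.
Qed.

Definition grassmann_mul (u v : G) : G :=
  Grassmann (body u * body v)
    (body u * coefx v + coefx u * body v)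
    (body u * coefy v + coefy u * body v)
    (body u * coefxy v + coefxy u * body v
       + coefx u * coefy v - coefy u * coefx v).

Lemma gcoefD (u v : G) :
  (body (u + v) = body u + body v) * (coefx (u + v) = coefx u + coefx v) *
  (coefy (u + v) = coefy u + coefy v) *
  (coefxy (u + v) = coefxy u + coefxy v).
Proof. by []. Qed.

Lemma gcoefN (u : G) :
  (body (- u) = - body u) * (coefx (- u) = - coefx u) *
  (coefy (- u) = - coefy u) * (coefxy (- u) = - coefxy u).
Proof. by []. Qed.

Lemma gcoef_Grassmann (a b c d : F) :
  (body (Grassmann a b c d) = a) * (coefx (Grassmann a b c d) = b) *
  (coefy (Grassmann a b c d) = c) * (coefxy (Grassmann a b c d) = d).
Proof. by []. Qed.

Lemma grassmann_mulA : associative grassmann_mul.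
Proof. by move=> u v w; apply: grassmannP; rewrite !gcoef_Grassmann; ring. Qed.

Lemma grassmann_mul1l : left_id (Grassmann 1 0 0 0) grassmann_mul.
Proof. by move=> u; apply: grassmannP; rewrite !gcoef_Grassmann; ring. Qed.

Lemma grassmann_mul1r : right_id (Grassmann 1 0 0 0) grassmann_mul.
Proof. by move=> u; apply: grassmannP; rewrite !gcoef_Grassmann; ring. Qed.

Lemma grassmann_mulDl : left_distributive grassmann_mul +%R.
Proof.
by move=> u v w; apply: grassmannP; rewrite !(gcoefD, gcoef_Grassmann); ring.
Qed.

Lemma grassmann_mulDr : right_distributive grassmann_mul +%R.
Proof.
by move=> u v w; apply: grassmannP; rewrite !(gcoefD, gcoef_Grassmann); ring.
Qed.

Lemma grassmann1_neq0 : Grassmann 1 0 0 0 != 0.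
Proof. by apply/eqP => /(congr1 body)/eqP; rewrite /body /= oner_eq0. Qed.

HB.instance Definition _ := GRing.Zmodule_isNzRing.Build G
  grassmann_mulA grassmann_mul1l grassmann_mul1r
  grassmann_mulDl grassmann_mulDr grassmann1_neq0.

Lemma gcoefM (u v : G) :
  (body (u * v) = body u * body v) *
  (coefx (u * v) = body u * coefx v + coefx u * body v) *
  (coefy (u * v) = body u * coefy v + coefy u * body v) *
  (coefxy (u * v) = body u * coefxy v + coefxy u * body v
     + coefx u * coefy v - coefy u * coefx v).
Proof. by []. Qed.

Lemma gcoef_zero :
  (body 0 = 0) * (coefx 0 = 0) * (coefy 0 = 0) * (coefxy 0 = 0).
Proof. by []. Qed.

Lemma gcoef_one :
  (body 1 = 1) * (coefx 1 = 0) * (coefy 1 = 0) * (coefxy 1 = 0).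
Proof. by []. Qed.

Definition gcoefE :=
  (gcoefD, gcoefN, gcoefM, gcoef_zero, gcoef_one, gcoef_Grassmann).

Definition grassmann_part (i : bool) : {pred G} := fun u =>
  if i then (body u == 0) && (coefxy u == 0)
  else (coefx u == 0) && (coefy u == 0).

Lemma grassmann_evenP (u : G) :
  reflect (coefx u = 0 /\ coefy u = 0) (u \in grassmann_part false).
Proof. by apply: (iffP andP) => -[/eqP ? /eqP ?]. Qed.

Lemma grassmann_oddP (u : G) :
  reflect (body u = 0 /\ coefxy u = 0) (u \in grassmann_part true).
Proof. by apply: (iffP andP) => -[/eqP ? /eqP ?]. Qed.

Lemma grassmann_part_zmod i : zmod_closed (grassmann_part i).
Proof.
case: i; split; try by rewrite unfold_in /= eqxx.
  move=> u v /grassmann_oddP[u1 u2] /grassmann_oddP[v1 v2].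
  by apply/grassmann_oddP; rewrite !gcoefE ?u1 ?u2 ?v1 ?v2 subr0.
move=> u v /grassmann_evenP[u1 u2] /grassmann_evenP[v1 v2].
by apply/grassmann_evenP; rewrite !gcoefE ?u1 ?u2 ?v1 ?v2 subr0.
Qed.

Lemma grassmann_part_sum (u : G) : exists v w,
  [/\ v \in grassmann_part false, w \in grassmann_part true & u = v + w].
Proof.
exists (Grassmann (body u) 0 0 (coefxy u)).
exists (Grassmann 0 (coefx u) (coefy u) 0).
split; [exact/grassmann_evenP|exact/grassmann_oddP|].
by apply: grassmannP; rewrite !gcoefE; ring.
Qed.

Lemma grassmann_part_direct (u : G) :
  u \in grassmann_part false -> u \in grassmann_part true -> u = 0.
Proof.
by move=> /grassmann_evenP[? ?] /grassmann_oddP[? ?]; exact: grassmannP.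
Qed.

Lemma grassmann_part1 : 1 \in grassmann_part false.
Proof. exact/grassmann_evenP. Qed.

Lemma grassmann_partM i j (u v : G) : u \in grassmann_part i ->
  v \in grassmann_part j -> u * v \in grassmann_part (i (+) j).
Proof.
case: i; case: j => /=.
- move=> /grassmann_oddP[u1 u2] /grassmann_oddP[v1 v2].
  by apply/grassmann_evenP; rewrite !gcoefE ?u1 ?v1; split; ring.
- move=> /grassmann_oddP[u1 u2] /grassmann_evenP[v1 v2].
  by apply/grassmann_oddP; rewrite !gcoefE ?u1 ?u2 ?v1 ?v2; split; ring.
- move=> /grassmann_evenP[u1 u2] /grassmann_oddP[v1 v2].
  by apply/grassmann_oddP; rewrite !gcoefE ?u1 ?u2 ?v1 ?v2; split; ring.
- move=> /grassmann_evenP[u1 u2] /grassmann_evenP[v1 v2].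
  by apply/grassmann_evenP; rewrite !gcoefE ?u1 ?u2 ?v1 ?v2; split; ring.
Qed.

Lemma grassmann_supercommutative i j (u v : G) : u \in grassmann_part i ->
  v \in grassmann_part j -> u * v = (-1) ^+ (i && j) * (v * u).
Proof.
case: i; case: j; rewrite /= ?expr0 ?expr1 ?mul1r ?mulN1r.
- move=> /grassmann_oddP[u1 u2] /grassmann_oddP[v1 v2].
  by apply/grassmannP; rewrite !gcoefE ?u1 ?u2 ?v1 ?v2; ring.
- move=> /grassmann_oddP[u1 u2] /grassmann_evenP[v1 v2].
  by apply/grassmannP; rewrite !gcoefE ?u1 ?u2 ?v1 ?v2; ring.
- move=> /grassmann_evenP[u1 u2] /grassmann_oddP[v1 v2].
  by apply/grassmannP; rewrite !gcoefE ?u1 ?u2 ?v1 ?v2; ring.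
- move=> /grassmann_evenP[u1 u2] /grassmann_evenP[v1 v2].
  by apply/grassmannP; rewrite !gcoefE ?u1 ?u2 ?v1 ?v2; ring.
Qed.

Lemma grassmann_two_regular (u : G) : u *+ 2 = 0 -> u = 0.
Proof.
move=> u2; suff h a : a + a = 0 -> a = 0 :> F.
  apply: grassmannP; apply: h; [exact: (congr1 body u2)|exact: (congr1 coefx u2)
    |exact: (congr1 coefy u2)|exact: (congr1 coefxy u2)].
by move/eqP; rewrite -mulr2n Num.Theory.mulrn_eq0 => /eqP.
Qed.

Definition gx : G := Grassmann 0 1 0 0.
Definition gy : G := Grassmann 0 0 1 0.

Lemma gx_odd : gx \in grassmann_part true.
Proof. exact/grassmann_oddP. Qed.

Lemma gy_odd : gy \in grassmann_part true.
Proof. exact/grassmann_oddP. Qed.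

Lemma grassmann_odd_nonzero : exists2 u : G, u \in grassmann_part true & u != 0.
Proof.
exists gx; first exact: gx_odd.
by apply/eqP => /(congr1 coefx)/eqP; rewrite !gcoefE oner_eq0.
Qed.

HB.instance Definition _ := NzRing_isSuperRing.Build G
  grassmann_part_zmod grassmann_part_sum grassmann_part_direct grassmann_part1
  grassmann_partM grassmann_supercommutative grassmann_two_regular
  grassmann_odd_nonzero.

(** * The unique maximal ideal *)

Definition grassmann_max : {pred G} := fun u => body u == 0.

(** For u = a + n with zero constant term in n, one has n^2 = 0, so that
    the inverse of u is (a - n) / a^2. *)
Definition grassmann_inv (u : G) : G :=
  Grassmann (body u)^-1 (- coefx u / body u ^+ 2)
    (- coefy u / body u ^+ 2) (- coefxy u / body u ^+ 2).

Lemma grassmann_mulV u : body u != 0 -> u * grassmann_inv u = 1.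
Proof. by move=> u1; apply: grassmannP; rewrite !gcoefE; field. Qed.

Lemma grassmann_mulVl u : body u != 0 -> grassmann_inv u * u = 1.
Proof. by move=> u1; apply: grassmannP; rewrite !gcoefE; field. Qed.

Lemma body_neq0_of_right_inverse (u v : G) : u * v = 1 -> body u != 0.
Proof.
move/(congr1 body)/eqP; rewrite !gcoefE; apply: contraL => /eqP->.
by rewrite mul0r eq_sym oner_eq0.
Qed.

Lemma invertibleE (u : G) : invertible u <-> body u != 0.
Proof.
split=> [[v [/body_neq0_of_right_inverse]] //|u1].
by exists (grassmann_inv u); rewrite grassmann_mulV ?grassmann_mulVl.
Qed.

Lemma not_invertible (u : G) : ~ invertible u <-> body u = 0.
Proof.
split=> [h|u0 /invertibleE]; last by rewrite u0 eqxx.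
by apply/eqP/negPn/negP => u1; apply/h/invertibleE.
Qed.

Lemma grassmann_max_ideal : ideal_closed grassmann_max.
Proof.
split; first split.
- exact: eqxx.
- move=> u v; rewrite !unfold_in /grassmann_max !gcoefE => /eqP-> /eqP->.
  by rewrite subr0.
move=> a u; rewrite !unfold_in /grassmann_max !gcoefE => /eqP->.
by rewrite mulr0 mul0r.
Qed.

(** Every element outside [grassmann_max] is a unit, hence in no maximal ideal m.
    Conversely, if u has zero constant term and were not in m, then some u v - 1
    would lie in m, but its constant term is -1 and it is a unit. *)
Lemma grassmann_local : local_ring grassmann_max.
Proof.
split; first split.
- exact: grassmann_max_ideal.
- by rewrite unfold_in /grassmann_max gcoefE oner_eq0.
- by move=> u v; rewrite unfold_in /grassmann_max !gcoefE; apply/eqP; ring.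
- move=> u u1; exists (grassmann_inv u).
  by rewrite grassmann_mulV // subrr unfold_in /grassmann_max gcoefE.
move=> m [[_ mM] m1 _ mV] u; apply/idP/idP => [um|].
  apply/negPn/negP => u1; case/negP: m1.
  by rewrite -(grassmann_mulV u1); case: (mM (grassmann_inv u) _ um).
rewrite unfold_in /grassmann_max => /eqP u1.
apply/negPn/negP => /mV[v vm]; case/negP: m1.
have uv1 : body (u * v - 1) != 0.
  by rewrite !gcoefE u1 mul0r sub0r oppr_eq0 oner_eq0.
by rewrite -(grassmann_mulV uv1); case: (mM (grassmann_inv (u * v - 1)) _ vm).
Qed.

(** * The even part, and the Krull superdimension *)

Local Notation E := (even_part G).

Lemma even_coef (r : E) : coefx (even_val r) = 0 /\ coefy (even_val r) = 0.
Proof. exact/grassmann_evenP/(valP r). Qed.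

Definition even_elt (a d : F) : E :=
  EvenPart (introT (grassmann_evenP (Grassmann a 0 0 d)) (conj erefl erefl)).

Lemma even_eltE (r : E) :
  r = even_elt (body (even_val r)) (coefxy (even_val r)).
Proof. by have [rx ry] := even_coef r; apply/val_inj/grassmannP. Qed.

Lemma even_eltM a d a' d' :
  even_elt a d * even_elt a' d' = even_elt (a * a') (a * d' + d * a').
Proof. by apply/val_inj/grassmannP; rewrite /= !gcoefE; ring. Qed.

Lemma even_elt1 : 1 = even_elt 1 0.
Proof. exact/val_inj. Qed.

Lemma even_elt0 : 0 = even_elt 0 0.
Proof. exact/val_inj. Qed.

Lemma even_square_zero_or_unit : square_zero_or_unit E.
Proof.
move=> r; rewrite (even_eltE r); set a := body _; set d := coefxy _.
have [->|a0] := eqVneq a 0.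
  by left; rewrite even_eltM even_elt0; congr even_elt; ring.
right; exists (even_elt a^-1 (- d / a ^+ 2)).
by rewrite even_eltM even_elt1; congr even_elt; field.
Qed.

(** The even part has only three ideals, generated by 1, by xy and by 0; which
    one it is can be read off from whether 1 and xy are members. *)
Lemma even_noetherian : noetherian E.
Proof.
move=> I [[I0 IB] IM].
suff [g Ig] : exists g, forall r, r \in I <-> exists c, r = c * g.
  exists 1%N, (fun=> g) => r; rewrite Ig.
  split=> [[c ->]|[c]]; last by rewrite big_ord1; exists (c ord0).
  by exists (fun=> c); rewrite big_ord1.
have gen g : g \in I -> (forall r, r \in I -> exists c, r = c * g) ->
    exists g, forall r, r \in I <-> exists c, r = c * g.
  by move=> gI h; exists g => r; split=> [/h //|[c ->]]; case: (IM c _ gI).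
have [I1|I1] := boolP (1 \in I).
  by apply: (gen 1) => // r _; exists r; rewrite mulr1.
have coef0 r : r \in I -> body (even_val r) = 0.
  move=> rI; apply/eqP/negPn/negP => r1; case/negP: I1.
  have [rr|[s <-]] := even_square_zero_or_unit r; last by case: (IM s _ rI).
  have := congr1 (fun s : E => body (even_val s)) rr; rewrite /= !gcoefE => /eqP.
  by rewrite mulf_eq0 (negbTE r1).
have [It|It] := boolP (even_elt 0 1 \in I).
  apply: (gen _ It) => r /coef0 r1; exists (even_elt (coefxy (even_val r)) 0).
  by rewrite [LHS]even_eltE r1 even_eltM; congr even_elt; ring.
apply: (gen 0) => // r rI; exists 0; rewrite mulr0 [LHS]even_eltE coef0 //.
set d := coefxy _; suff -> : d = 0 by rewrite even_elt0.
apply/eqP/negPn/negP => d0; case/negP: It.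
have [+ _] := IM (even_elt d^-1 0) _ rI.
rewrite [X in _ * X]even_eltE coef0 // even_eltM -/d.
by rewrite mulr0 mulVf // mulr0 addr0.
Qed.

Lemma odd_decomposition (u : G) : u \in odd_pred G ->
  u = even_val (even_elt (coefx u) 0) * gx
    + even_val (even_elt (coefy u) 0) * gy.
Proof.
by case/grassmann_oddP=> u1 u2; apply: grassmannP; rewrite !gcoefE ?u1 ?u2; ring.
Qed.

Definition gens (i : 'I_2) : G := if i == ord0 then gx else gy.

Lemma grassmann_noetherian : super_noetherian G.
Proof.
split; first exact: even_noetherian.
exists 2, gens; split=> [i|u /odd_decomposition uE].
  by rewrite /gens; case: ifP => _; [exact: gx_odd|exact: gy_odd].
exists (fun i : 'I_2 => even_elt (if i == ord0 then coefx u else coefy u) 0).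
by rewrite big_ord_recl big_ord1.
Qed.

Lemma grassmann_odd_product3 (u v w : G) : u \in odd_pred G ->
  v \in odd_pred G -> w \in odd_pred G -> u * (v * w) = 0.
Proof.
case/grassmann_oddP=> u1 u2 /grassmann_oddP[v1 v2] /grassmann_oddP[w1 w2].
by apply: grassmannP; rewrite !gcoefE ?u1 ?u2 ?v1 ?v2 ?w1 ?w2; ring.
Qed.

(** All the Krull dimensions involved are 0, so only the vanishing of products
    of odd elements matters. *)
Lemma grassmann_Ksdim : Ksdim_is G 0 2.
Proof.
have K0 := Kdim0 even_square_zero_or_unit.
split=> //.
  exists gens; split.
    by move=> i; rewrite /gens; case: ifP => _; [exact: gx_odd|exact: gy_odd].
  have nz : \prod_i gens i != 0.
    rewrite big_ord_recl big_ord1; apply/eqP => /(congr1 coefxy)/eqP.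
    by rewrite !gcoefE !(mul0r, mulr0, mul1r, add0r, subr0) oner_eq0.
  exists nz, 0; split=> //.
  exact/Kdim0/square_zero_or_unit_quotient/even_square_zero_or_unit.
case=> [|[|[|n]]] // a [aodd [nz _]]; case/eqP: nz.
rewrite 3!big_ord_recl /= 2!mulrA -[X in X * _]mulrA.
by rewrite grassmann_odd_product3 ?mul0r.
Qed.

(** * The cotangent space *)

Lemma gcoef_sum n (u : 'I_n -> G) :
  (body (\sum_i u i) = \sum_i body (u i)) *
  (coefx (\sum_i u i) = \sum_i coefx (u i)) *
  (coefy (\sum_i u i) = \sum_i coefy (u i)).
Proof. by do !split; apply: big_morph. Qed.

Lemma grassmann_max_sqr (u : G) :
  ideal_sqr grassmann_max u -> coefx u = 0 /\ coefy u = 0.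
Proof.
case=> n [v [w [vw ->]]]; rewrite !gcoef_sum.
split; apply: big1 => i _; have [/eqP v1 /eqP w1] := vw i;
  by rewrite !gcoefE v1 w1; ring.
Qed.

(** An even element of the maximal ideal is d xy, the product of x and d y. *)
Lemma cotangent_even : cotangent_dim_is grassmann_max false 0.
Proof.
exists (fun=> 0); split; [by case| |by move=> c _; case].
move=> u /eqP u1 /grassmann_evenP[u2 u3]; exists (fun=> 0).
exists 1, (fun=> gx), (fun=> Grassmann 0 0 (coefxy u) 0).
split; first by move=> i; rewrite !unfold_in /grassmann_max !gcoefE !eqxx.
by rewrite big_ord0 big_ord1 subr0; apply: grassmannP;
  rewrite !gcoefE ?u1 ?u2 ?u3; ring.
Qed.

Lemma cotangent_odd : cotangent_dim_is grassmann_max true 2.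
Proof.
exists gens; split.
- move=> i; rewrite /gens; case: ifP => _.
    by split; [exact: eqxx|exact: gx_odd].
  by split; [exact: eqxx|exact: gy_odd].
- move=> u _ /odd_decomposition uE.
  exists (fun i : 'I_2 =>
    even_val (even_elt (if i == ord0 then coefx u else coefy u) 0)).
  rewrite big_ord_recl big_ord1 -uE subrr.
  by exists 0, (fun=> 0), (fun=> 0); split; [case|rewrite big_ord0].
- move=> c /grassmann_max_sqr; rewrite big_ord_recl big_ord1 !gcoefE.
  rewrite !(mulr0, mulr1, addr0, add0r) => -[c0 c1] j; rewrite unfold_in.
  rewrite /grassmann_max; case: j => [[|[|//]] jP].
    by apply/eqP; rewrite -[RHS]c0; congr (body (c _)); exact: val_inj.
  by apply/eqP; rewrite -[RHS]c1; congr (body (c _)); exact: val_inj.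
Qed.

Lemma grassmann_regular : regular_local grassmann_max.
Proof.
split; [exact: grassmann_local|exact: grassmann_noetherian|].
exists 0, 2.
by split; [exact: grassmann_Ksdim|exact: cotangent_even|exact: cotangent_odd].
Qed.

Lemma grassmann_two_regular_mod : two_regular_mod grassmann_max.
Proof.
move=> u; rewrite mulr2n !unfold_in /grassmann_max gcoefE -mulr2n.
by rewrite Num.Theory.mulrn_eq0.
Qed.

(** * Failure of unique factorization *)

Lemma linear_irreducible (u : G) : body u = 0 ->
  coefx u != 0 \/ coefy u != 0 -> irreducible_elt u.
Proof.
move=> u1 ulin; split; first exact/not_invertible.
move=> -[a [b [/not_invertible a0 /not_invertible b0 ue]]].
by case: ulin; rewrite ue !gcoefE a0 b0 !(mul0r, mulr0) addr0 eqxx.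
Qed.

Lemma odd_normal_irreducible (u : G) : u \in odd_pred G -> u != 0 ->
  normal_elt u /\ irreducible_elt u.
Proof.
move=> uodd u0; split; first exact: normal_homogeneous uodd.
have /grassmann_oddP[u1 u2] := uodd; apply: linear_irreducible => //.
have [x0|] := eqVneq (coefx u) 0; last by left.
right; apply: contra_neq u0 => y0; exact: grassmannP.
Qed.

(** Modulo the square of the maximal ideal, multiplying an element of that ideal
    by a b amounts to scaling it by the constant term of a b. *)
Lemma associated_linear_part (u v : G) : associated u v -> body v = 0 ->
  exists k, coefx u = k * coefx v /\ coefy u = k * coefy v.
Proof.
move=> [a [b [_ _ ->]]] v1; exists (body a * body b).
by rewrite !gcoefE v1; split; ring.
Qed.

(** Every factor of (x + y)y has coefficient 1 at y, so the factor x of xy, whose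
    coefficient at y is 0, could only be associated to one of them with
    proportionality constant 0. *)
Lemma grassmann_not_UFSR : ~ UFSR G.
Proof.
pose g (i : 'I_2) : G := if i == ord0 then gx + gy else gy.
have nz (u : G) : coefx u = 1 \/ coefy u = 1 -> u != 0.
  by case=> u1; apply: contra_eq_neq u1 => ->; rewrite gcoefE eq_sym oner_neq0.
have f1 : factorization (gx * gy) gens.
  split=> [i|]; last by rewrite big_ord_recl big_ord1.
  rewrite /gens; case: ifP => _; apply: odd_normal_irreducible.
  - exact: gx_odd.
  - by apply: nz; left.
  - exact: gy_odd.
  - by apply: nz; right.
have f2 : factorization (gx * gy) g.
  split=> [i|].
    rewrite /g; case: ifP => _; apply: odd_normal_irreducible.
    - by apply/grassmann_oddP; rewrite !gcoefE addr0.
    - by apply: nz; left; rewrite !gcoefE addr0.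
    - exact: gy_odd.
    - by apply: nz; right.
  by rewrite big_ord_recl big_ord1; apply: grassmannP; rewrite !gcoefE; ring.
have xy0 : gx * gy != 0.
  apply/eqP => /(congr1 coefxy)/eqP.
  by rewrite !gcoefE !(mul0r, mulr0, mul1r, add0r, subr0) oner_eq0.
have xyN : ~ invertible (gx * gy) by apply/not_invertible; rewrite !gcoefE mul0r.
move=> /(_ _ xy0 xyN)[_ /(_ _ _ _ _ f1 f2)[e [s /(_ ord0)]]].
have g1 j : body (g j) = 0 by rewrite /g; case: ifP; rewrite !gcoefE ?addr0.
have gy1 j : coefy (g j) = 1 by rewrite /g; case: ifP; rewrite !gcoefE ?add0r.
move=> /associated_linear_part/(_ (g1 _))[k []].
rewrite gy1 /gens eqxx !gcoefE mulr1 => kx k0.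
by move/eqP: kx; rewrite -k0 mul0r oner_eq0.
Qed.

End Grassmann.

Theorem mainTheorem3 :
  exists (R : superRingType) (m : {pred R}),
    [/\ regular_local m, two_regular_mod m & ~ UFSR R].
Proof.
exists (grassmann rat), (@grassmann_max rat); split.
- exact: grassmann_regular.
- exact: grassmann_two_regular_mod.
- exact: grassmann_not_UFSR.
Qed.
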